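(* Let $K$ be a field and $S=K[x_1,\ldots,x_n]$. Let $I\subset S$ be a strong polymatroidal ideal which is not of Veronese type. Then $I$ is equidimensional if and only if $\sqrt I$ is a principal ideal.
   Context: Let $\mathbb Z_+^n$ be the set of vectors in $\mathbb Z^n$ with nonnegative entries, $\varepsilon_1,\ldots,\varepsilon_n$ the canonical basis vectors, $|u|=\sum_i u_i$ for $u\in\mathbb Z_+^n$, and $[n]=\{1,\ldots,n\}$. For $u,v\in\mathbb Z_+^n$ write $v\leq u$ if $v_i\leq u_i$ for all $i$. A discrete polymatroid on $[n]$ is a non-empty finite subset $P\subset\mathbb Z_+^n$ such that (1) if $u\in P$, $v\in\mathbb Z_+^n$ and $v\leq u$, then $v\in P$; (2) if $u,v\in P$ with $|u|<|v|$, then there is $i\in[n]$ with $u_i<v_i$ and $u+\varepsilon_i\in P$. A base of $P$ is an element of $P$ that is maximal with respect to $\leq$; $B(P)$ is the set of bases. All bases have the same modulus $|u|$. $P$ satisfies the strong exchange property if for all $u,v\in B(P)$ and all $i,j\in[n]$ with $u_i>v_i$ and $u_j<v_j$ one has $u-\varepsilon_i+\varepsilon_j\in B(P)$. The polymatroidal ideal of $P$ is the ideal of $S$ generated by all monomials $x^v=x_1^{v_1}\cdots x_n^{v_n}$ with $v\in B(P)$. A strong polymatroidal ideal is the polymatroidal ideal of a discrete polymatroid satisfying the strong exchange property. An ideal is of Veronese type if it is of the form $I_{d;a_1,\ldots,a_n}$ for some nonnegative integers $d,a_1,\ldots,a_n$ with $a_i\leq d$ for all $i$ and $\sum_i a_i\geq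 d$, where $I_{d;a_1,\ldots,a_n}$ is the ideal generated by all monomials $x^u$ with $|u|=d$ and $0\leq u_i\leq a_i$ for all $i$. An ideal $J$ of $S$ is equidimensional if $\dim(S/\mathfrak p)$ is the same number for all minimal primes $\mathfrak p$ of $J$. *)

(* Defs.v *)
From HB Require Import structures.
From mathcomp Require Import all_boot all_order all_algebra.
From mathcomp Require Import finmap.
From mathcomp Require Import mpoly.

Set Implicit Arguments.
Unset Strict Implicit.
Unset Printing Implicit Defensive.

Import GRing.Theory.
Local Open Scope ring_scope.

(* An ideal is a predicate [R -> Prop].  The library's [idealr] and
   [prime_idealr] are boolean and proper; they are used below only for prime
   ideals, where properness is wanted, so that [{ideal_quot p}] is available.
   Classically, every prime ideal is the extension of a [prime_idealr]. *)

Section CommutativeAlgebra.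
Variable R : comNzRingType.
Implicit Types (J : R -> Prop) (p q : prime_idealr R).

Definition ideal_gen (G : R -> Prop) (f : R) : Prop :=
  exists2 s : seq (R * R),
    forall ag, ag \in s -> G ag.2 & f = \sum_(ag <- s) ag.1 * ag.2.

Definition eq_ideal J J' : Prop := forall f, J f <-> J' f.

Definition radical J (f : R) : Prop := exists k : nat, J (f ^+ k).

Definition principal_ideal J : Prop :=
  exists g : R, forall f, J f <-> exists a : R, f = a * g.

Definition minimal_prime J p : Prop :=
  (forall f, J f -> f \in p) /\
  forall q, (forall f, J f -> f \in q) ->
    {subset q <= p} -> {subset p <= q}.

(* [c 0], ..., [c d] is a strictly increasing chain of prime ideals, of
   length [d]; the values of [c] beyond [d] are irrelevant. *)
Definition prime_chain (d : nat) (c : nat -> prime_idealr R) : Prop :=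
  forall i, (i < d)%N -> {subset c i <= c i.+1} /\ ~ {subset c i.+1 <= c i}.

Definition has_krull_dim (d : nat) : Prop :=
  (exists c, prime_chain d c) /\
  forall e c, prime_chain e c -> (e <= d)%N.

End CommutativeAlgebra.

Definition equidimensional (R : comNzRingType) (J : R -> Prop) : Prop :=
  exists d : nat, forall p : prime_idealr R,
    minimal_prime J p -> has_krull_dim {ideal_quot p} d.

Section DiscretePolymatroids.
Variable n : nat.
Implicit Types (P : {fset 'X_{1..n}}) (u v : 'X_{1..n}).

Definition discrete_polymatroid P : Prop :=
  [/\ P != fset0,
      forall u v, u \in P -> (v <= u)%MM -> v \in P
    & forall u v, u \in P -> v \in P -> (mdeg u < mdeg v)%N ->
        exists2 i : 'I_n, (u i < v i)%N & (u + U_(i))%MM \in P].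

Definition base P u : Prop :=
  u \in P /\ forall v, v \in P -> (u <= v)%MM -> v = u.

(* The subtraction of multinomials is truncated, but here [v i < u i] gives
   [0 < u i]. *)
Definition strong_exchange P : Prop :=
  forall u v, base P u -> base P v ->
  forall i j : 'I_n, (v i < u i)%N -> (u j < v j)%N ->
    base P (u - U_(i) + U_(j))%MM.

End DiscretePolymatroids.

Section MonomialIdeals.
Variables (K : fieldType) (n : nat).
Implicit Type I : {mpoly K[n]} -> Prop.

Definition monomial_ideal (M : 'X_{1..n} -> Prop) : {mpoly K[n]} -> Prop :=
  ideal_gen (fun f => exists2 u, M u & f = 'X_[u]).

Definition polymatroidal_ideal (P : {fset 'X_{1..n}}) : {mpoly K[n]} -> Prop :=
  monomial_ideal (base P).

Definition strong_polymatroidal I : Prop :=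
  exists P : {fset 'X_{1..n}},
    [/\ discrete_polymatroid P, strong_exchange P
      & eq_ideal I (polymatroidal_ideal P)].

Definition veronese_ideal (d : nat) (a : 'I_n -> nat) : {mpoly K[n]} -> Prop :=
  monomial_ideal (fun u => mdeg u = d /\ forall i, (u i <= a i)%N).

Definition veronese_type I : Prop :=
  exists (d : nat) (a : 'I_n -> nat),
    [/\ forall i, (a i <= d)%N, (d <= \sum_(i < n) a i)%N
      & eq_ideal I (veronese_ideal d a)].

End MonomialIdeals.

(* Main.v *)
(* If every variable is missing from some base, then for i <> j the strong
   exchange property yields a base v with v_i = 0 and v_j maximal, and descent on
   the distance to a given vector shows that the ideal is of Veronese type.
   Otherwise some x_i divides all generators, and (x_i) is a minimal prime of
   dimension n - 1.  If the ideal is equidimensional, every minimal set F of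
   variables meeting the support of all bases is therefore a singleton, so its
   element lies in the set D of common variables.  Hence the complement of D
   misses the support of some base, and the radical is generated by the product
   of the x_i, i in D.  Conversely, if the radical is (g), then g divides a
   monomial, so every minimal prime contains, hence equals, some (x_j).

   The dimension theory needed is dim K[x_1,...,x_n] <= n.  Given a strict chain
   of primes with n+1 steps c_i < c_(i+1), pick y_i in c_(i+1) outside c_i; a
   counting argument gives a nontrivial algebraic relation between the n+1
   elements y_i, and reducing this relation along the chain puts a nonzero
   constant in a prime. *)
Require Import Defs.
From HB Require Import structures.
From Stdlib Require Import Classical_Pred_Type.
From mathcomp Require Import all_boot all_order all_algebra.
From mathcomp Require Import finmap.
From mathcomp Require Import mpoly.

Set Implicit Arguments.
Unset Strict Implicit.
Unset Printing Implicit Defensive.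

Import GRing.Theory.
Local Open Scope ring_scope.
Local Open Scope quotient_scope.

(** * Prime ideals *)

Definition zero_ideal (R : idomainType) : R -> bool := fun x => x == 0.

Lemma zero_ideal_closed (R : idomainType) : idealr_closed (@zero_ideal R).
Proof.
split; rewrite /in_mem /= /zero_ideal ?eqxx ?oner_eq0 // => a u v.
by rewrite /in_mem /= => /eqP -> /eqP ->; rewrite mulr0 addr0.
Qed.

Lemma zero_ideal_prime (R : idomainType) : prime_idealr_closed (@zero_ideal R).
Proof. by move=> u v; rewrite /in_mem /= /zero_ideal mulf_eq0. Qed.

HB.instance Definition _ (R : idomainType) :=
  isIdealr.Build R (@zero_ideal R) (@zero_ideal_closed R).
HB.instance Definition _ (R : idomainType) :=
  isPrimeIdealrClosed.Build R (@zero_ideal R) (@zero_ideal_prime R).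

Section Comap.
Variables (R R' : comNzRingType) (phi : {rmorphism R -> R'}).
Variable p : prime_idealr R'.

(** Serves twice: kernels of substitutions give the primes generated by variables, and preimages
    under a quotient map carry chains back to the ring. *)
Definition comap_ideal : R -> bool := fun x => phi x \in p.

Lemma comap_idealE x : (x \in comap_ideal) = (phi x \in p).
Proof. by []. Qed.

Lemma comap_ideal_closed : idealr_closed comap_ideal.
Proof.
split=> [||a u v]; rewrite !comap_idealE ?rmorph0 ?rmorph1 ?rpred0 ?idealr1 //.
by move=> pu pv; rewrite rmorphD rmorphM rpredD // idealMr.
Qed.

Lemma comap_ideal_prime : prime_idealr_closed comap_ideal.
Proof. by move=> u v; rewrite !comap_idealE rmorphM prime_idealrM. Qed.

HB.instance Definition _ := isIdealr.Build R comap_ideal comap_ideal_closed.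
HB.instance Definition _ :=
  isPrimeIdealrClosed.Build R comap_ideal comap_ideal_prime.

End Comap.

Lemma mem_ideal_sub (R : nzRingType) (q : idealr R) x y :
  x - y \in q -> (x \in q) = (y \in q).
Proof. by move=> qd; rewrite -(subrK y x) rpredDl. Qed.

Section QuotientIdeal.
Variables (R : comNzRingType) (p q : prime_idealr R).

(** Membership is read off the canonical representative; since [p] lies in [q], every other
    representative gives the same answer. *)
Definition quot_ideal (spq : {subset p <= q}) : {ideal_quot p} -> bool :=
  fun z => repr z \in q.

Variable spq : {subset p <= q}.

Lemma quot_ideal_pi x : (\pi_{ideal_quot p} x \in quot_ideal spq) = (x \in q).
Proof.
apply: mem_ideal_sub; apply: spq.
by rewrite Quotient.idealrBE reprK.
Qed.

Lemma quot_ideal_closed : idealr_closed (quot_ideal spq).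
Proof.
split; rewrite -?(rmorph0 (\pi_{ideal_quot p})) -?(rmorph1 (\pi_{ideal_quot p})).
- by rewrite quot_ideal_pi rpred0.
- by rewrite quot_ideal_pi idealr1.
move=> a u v; rewrite -[a]reprK -[u]reprK -[v]reprK !quot_ideal_pi => qu qv.
by rewrite -rmorphM -rmorphD quot_ideal_pi rpredD // idealMr.
Qed.

Lemma quot_ideal_prime : prime_idealr_closed (quot_ideal spq).
Proof.
move=> u v; rewrite -[u]reprK -[v]reprK -rmorphM !quot_ideal_pi.
by rewrite prime_idealrM.
Qed.

HB.instance Definition _ :=
  isIdealr.Build _ (quot_ideal spq) quot_ideal_closed.
HB.instance Definition _ :=
  isPrimeIdealrClosed.Build _ (quot_ideal spq) quot_ideal_prime.

End QuotientIdeal.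

(** * The Krull dimension of a polynomial ring *)

Section EvaluationByLastVariable.
Variables (r : nat) (K : comNzRingType).
Implicit Type Q : {mpoly K[r.+1]}.

(** Splitting off the last variable is what allows induction on the number of variables along a
    chain of primes. *)
Lemma mmap_muni (A : comNzRingType) (f : {rmorphism K -> A})
    (h : 'I_r.+1 -> A) Q :
  mmap f h Q
  = (map_poly (mmap f (h \o widen_ord (leqnSn r))) (muni Q)).[h ord_max].
Proof.
rewrite muniE rmorph_sum horner_sum; apply: eq_bigr => m _.
rewrite /= map_polyZ map_polyXn hornerZ hornerXn /= mmapZ mmapX -mulrA.
rewrite /mmap1 big_ord_recr /=; congr (_ * (_ * _)).
by apply: eq_bigr => i _; rewrite mnmE.
Qed.

(** A monomial is determined by its last exponent and its truncation [m'], so no cancellation occurs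
    and each coefficient of [Q] survives in [muni Q]. *)
Lemma muni_neq0 Q : Q != 0 -> muni Q != 0.
Proof.
rewrite -msupp_eq0; case E: (msupp Q) => [//|m s] _.
have ms : m \in msupp Q by rewrite E mem_head.
pose m' := [multinom m (widen_ord (leqnSn r) i) | i < r].
apply: contraTneq ms => Q0; rewrite mcoeff_msupp negbK.
have : ((muni Q)`_(m ord_max))@_m' = 0 by rewrite Q0 coef0 mcoeff0.
rewrite muniE coef_sum raddf_sum /= => H.
case: (boolP (m \in msupp Q)) => [mQ|]; last by rewrite mcoeff_eq0.
rewrite -H (bigD1_seq m) ?msupp_uniq //= coefZ coefXn eqxx mulr1.
rewrite mcoeffZ mcoeffX eqxx mulr1 big1 ?addr0 // => k km.
rewrite coefZ coefXn; case: (m ord_max =P k ord_max) => [Ek|]; last first.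
  by rewrite mulr0 mcoeff0.
rewrite mulr1 mcoeffZ mcoeffX; case: eqP => [Em'|]; last by rewrite mulr0.
case/eqP: km; apply/mnmP => i; case: (unliftP ord_max i) => [j ->|-> //].
have -> : lift ord_max j = widen_ord (leqnSn r) j by apply/val_inj; apply: lift_max.
by have /mnmP/(_ j) := Em'; rewrite !mnmE.
Qed.

End EvaluationByLastVariable.

Section PrimeChains.
Variable A : comNzRingType.

(** While the constant term vanishes, a factor [y] outside [p] can be cancelled and the value stays
    in [p]. After [k] cancellations the value is the wanted coefficient plus a multiple of [y], and
    both the value and [y] lie in [q]. *)
Lemma horner_mem_prime (p q : prime_idealr A) y (g : {poly A}) k :
  {subset p <= q} -> y \in q -> y \notin p -> g.[y] \in p ->
  (forall i, (i < k)%N -> g`_i = 0) -> g`_k \in q.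
Proof.
move=> pq yq yp; elim: k g => [|k IH] g; elim/poly_ind: g => [|g c _].
- by rewrite coef0 rpred0.
- rewrite hornerMXaddC coefD coefMX coefC add0r => /pq gq _.
  by rewrite -(rpredDl c (idealMr g.[y] yq)).
- by rewrite coef0 rpred0.
rewrite hornerMXaddC coefD coefMX coefC /= addr0 => gp g0.
have c0 : c = 0 by have := g0 0%N; rewrite coefD coefMX coefC /= add0r; apply.
move: gp; rewrite c0 addr0 prime_idealrM (negPf yp) orbF => gp.
apply: IH gp _ => i ik; have := g0 i.+1.
by rewrite coefD coefMX coefC /= addr0; apply.
Qed.

(* Peeling off [y 0] divides by the largest power of [y 0], which is outside
   [c 0], and then reduces modulo [c 1], which contains [y 0]. *)
Lemma mmap_notin_chain (K : fieldType) (f : {rmorphism K -> A}) r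
    (c : nat -> prime_idealr A) (y : nat -> A) :
    (forall i, (i < r)%N ->
      [/\ {subset c i <= c i.+1}, y i \in c i.+1 & y i \notin c i]) ->
  forall Q : {mpoly K[r]}, Q != 0 ->
    mmap f (fun i => y (r.-1 - i)%N) Q \notin c 0.
Proof.
elim: r c y => [|r IH] c y cy Q Q0.
  have EQ : Q = (Q@_0)%:MP.
    apply/mpolyP => m; rewrite mcoeffC; have -> : m = 0%MM by apply/mnmP => -[].
    by rewrite eqxx mulr1.
  rewrite EQ mmapC; apply/negP => fc; have := idealr1 (c 0).
  (* A nonzero constant is invertible, so its image in [c 0] would put 1 there. *)
  rewrite -(rmorph1 f) -(mulVf (_ : Q@_0 != 0)) ?rmorphM ?idealMr //.
  by apply: contraNneq Q0 => E; rewrite EQ E mpolyC0.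
(* The variables are evaluated in reverse order, so the last one, singled out by [muni], takes the
   value [y 0]. *)
apply/negP; rewrite mmap_muni /= subnn => Qc.
have [c01 y1 y0] := cy 0 isT.
set h := (_ \o _) in Qc.
have Eh : h =1 fun i : 'I_r => y (r.-1 - i).+1%N.
  move=> i; rewrite /h /=; congr y; case: i => i /=.
  by case: r {IH cy Q Q0 Qc h} => // r ir; rewrite subSn.
have ex : exists k, (muni Q)`_k != 0.
  by exists (size (muni Q)).-1; rewrite -lead_coefE lead_coef_eq0 muni_neq0.
case: (ex_minnP ex) => k kQ kmin.
have /negP := IH (c \o S) (y \o S) (fun i ir => cy i.+1 ir) _ kQ; apply.
rewrite /= (_ : mmap f _ _ = (map_poly (mmap f h) (muni Q))`_k); last first.
  rewrite coef_map /= /mmap; apply: eq_bigr => m _; congr (_ * _).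
  by apply: mmap1_eq => i; rewrite Eh.
apply: horner_mem_prime c01 y1 y0 Qc _ => i ik; rewrite coef_map /=.
suff -> : (muni Q)`_i = 0 by rewrite mmap0.
by apply: contraTeq ik => /kmin; rewrite -leqNgt.
Qed.

End PrimeChains.

(** * Algebraic dependence of n+1 polynomials in n variables *)

Section AlgebraicDependence.
Variables (K : fieldType) (n : nat).

Lemma msize_mmap1_le r (y : 'I_r -> {mpoly K[n]}) D (a : 'X_{1..r}) :
  (forall i, msize (y i) <= D.+1)%N ->
  (msize (mmap1 y a) <= (mdeg a * D).+1)%N.
Proof.
move=> yD; rewrite /mmap1 mdegE big_distrl /=.
have ms1 : (msize (1 : {mpoly K[n]}) <= 1)%N by rewrite msize1.
(* [msize] is the degree plus one, but 0 at the zero polynomial, hence the separate treatment of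
   zero factors. *)
have msM (p q : {mpoly K[n]}) i j :
    (msize p <= i.+1 -> msize q <= j.+1 -> msize (p * q) <= (i + j).+1)%N.
  have [->|p0] := eqVneq p 0; first by rewrite mul0r msize0.
  have [->|q0] := eqVneq q 0; first by rewrite mulr0 msize0.
  by move=> pi qj; rewrite msizeM // -subn1 leq_subLR add1n -addSn -addnS leq_add.
elim/big_ind2: _ => // [p i q j|i _]; first exact: msM.
elim: (a i) => [|k IH]; first by rewrite expr0.
by rewrite exprS mulSn; apply: msM.
Qed.

Lemma algebraic_dependence (y : 'I_n.+1 -> {mpoly K[n]}) :
  exists2 Q : {mpoly K[n.+1]}, Q != 0 & mmap (@mpolyC n K) y Q = 0.
Proof.
pose D := (\max_i msize (y i))%N.
(* Monomials with exponents below [N] number N^(n+1), and their values at [y] have degree below [M],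
   so they involve at most M^n monomials. As M <= N C, the choice of [N] gives M^n <= N^n C^n <
   N^(n+1). *)
pose C := (n.+1 * D).+1; pose N := (C ^ n).+1.
pose M := (n.+1 * N * D).+1.
have yD i : (msize (y i) <= D.+1)%N.
  by apply: leqW; rewrite /D (bigD1 i) //= leq_maxl.
pose T := {ffun 'I_n.+1 -> 'I_N}; pose U := {ffun 'I_n -> 'I_M}.
have cardUT : (#|{: U}| < #|{: T}|)%N.
  rewrite !card_ffun !card_ord.
  have MN : (M <= N * C)%N.
    rewrite (mulnS N _ : N * C = _)%N /M (mulnC n.+1 N) -mulnA -[leqLHS]add1n leq_add2r.
    exact: ltn0Sn.
  have powMN k : (M ^ k <= (N * C) ^ k)%N.
    by elim: k => // k IH; rewrite !expnS leq_mul.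
  apply: leq_ltn_trans (powMN n) _.
  by rewrite expnMn expnSr ltn_pmul2l ?expn_gt0 ?ltnSn.
pose mT (a : T) : 'X_{1..n.+1} := [multinom val (a i) | i < n.+1].
pose mU (b : U) : 'X_{1..n} := [multinom val (b i) | i < n].
pose A := \matrix_(i < #|{: T}|, j < #|{: U}|)
  (mmap1 y (mT (enum_val i)))@_(mU (enum_val j)).
(* More rows than columns: a nonzero vector of the left kernel supplies the coefficients of [Q]. *)
have : kermx A != 0.
  rewrite -mxrank_eq0 mxrank_ker subn_eq0 -ltnNge.
  exact: leq_ltn_trans (rank_leq_col A) cardUT.
case/rowV0Pn => v /sub_kermxP vA v0.
pose Q : {mpoly K[n.+1]} := \sum_(i < #|{: T}|) v 0 i *: 'X_[mT (enum_val i)].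
exists Q.
  apply: contraNneq v0 => Q0; apply/eqP/rowP => i; rewrite mxE.
  have : Q@_(mT (enum_val i)) = 0 by rewrite Q0 mcoeff0.
  rewrite raddf_sum (bigD1 i) //= mcoeffZ mcoeffX eqxx mulr1 big1 ?addr0 //.
  move=> j ji; rewrite mcoeffZ mcoeffX; case: eqP => [E|]; last by rewrite mulr0.
  case/eqP: ji; apply: enum_val_inj; apply/ffunP => k; apply: val_inj.
  by have /mnmP/(_ k) := E; rewrite !mnmE.
apply/mpolyP => m; rewrite mcoeff0 (raddf_sum (mmap (@mpolyC n K) y)) raddf_sum /=.
under eq_bigr => i _ do rewrite mmapZ mmapX mcoeffCM.
(* In degree [M] and above all coefficients vanish by the degree bound; below, they are the columns
   of [A]. *)
case: (ltnP (mdeg m) M) => mM; last first.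
  apply: big1 => i _; rewrite memN_msupp_eq0 ?mulr0 // msize_mdeg_ge //.
  apply: leq_trans (msize_mmap1_le _ yD) _; apply: leq_trans mM.
  rewrite ltnS leq_mul2r mdegE; apply/orP; right.
  rewrite -[n.+1 in leqRHS]card_ord -sum_nat_const leq_sum // => j _.
  by rewrite mnmE; apply: ltnW (ltn_ord _).
have mj (j : 'I_n) : (m j < M)%N.
  by apply: leq_ltn_trans mM; rewrite mdegE (bigD1 j) //= leq_addr.
have := congr1 (fun w : 'rV_#|{: U}| => w 0 (enum_rank [ffun j => Ordinal (mj j)])) vA.
rewrite !mxE => E; rewrite -[RHS]E; apply: eq_bigr => i _; rewrite mxE.
by rewrite enum_rankK; congr (_ * _@__); apply/mnmP => j; rewrite mnmE ffunE.
Qed.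

End AlgebraicDependence.

Lemma prime_chain_witnesses (A : comNzRingType) e (c : nat -> prime_idealr A) :
  prime_chain e c ->
  exists y : nat -> A,
    forall i, (i < e)%N -> (y i \in c i.+1) && (y i \notin c i).
Proof.
move=> cc.
have /fin_all_exists [y yP] (i : 'I_e) :
    exists x, (x \in c i.+1) && (x \notin c i).
  have [_ ci] := cc i (ltn_ord i); have [x cx] := not_all_ex_not _ _ ci.
  by exists x; apply: contra_notT cx; rewrite negb_and negbK => /orP[/negPf -> //|].
(* The finite choice is extended by 0 to indices from [e] on, about which nothing is claimed. *)
exists (fun i => oapp y 0 (insub i)) => i ie.
by rewrite insubT /=; apply: (yP (Ordinal ie)).
Qed.

Theorem prime_chain_mpoly (K : fieldType) n e
    (c : nat -> prime_idealr {mpoly K[n]}) : prime_chain e c -> (e <= n)%N.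
Proof.
move=> cc; have [y yP] := prime_chain_witnesses cc.
rewrite leqNgt; apply/negP => ne.
have [Q Q0 Qy] := algebraic_dependence (fun i : 'I_n.+1 => y (n - i)%N).
suff : mmap (@mpolyC n K) (fun i : 'I_n.+1 => y (n - i)%N) Q \notin c 0.
  by rewrite Qy rpred0.
apply: (@mmap_notin_chain _ _ _ n.+1 c y _ _ Q0) => i ni; have ie := leq_trans ni ne.
by have [c_i _] := cc i ie; have /andP[] := yP i ie.
Qed.

(** * Primes generated by variables *)

Section VariableIdeals.
Variables (K : fieldType) (n : nat).
Implicit Types (F : {set 'I_n}) (q : prime_idealr {mpoly K[n]}).

Lemma mpolyXU_neq0 i : 'X_i != 0 :> {mpoly K[n]}.
Proof.
by apply/eqP => /(congr1 (mcoeff U_(i)))/eqP; rewrite mcoeffXU eqxx mcoeff0 oner_eq0.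
Qed.

Definition kill_vars F : {rmorphism {mpoly K[n]} -> {mpoly K[n]}} :=
  mmap (@mpolyC n K) (fun i => if i \in F then 0 else 'X_i).

(** The ideal generated by the variables in [F], encoded as a kernel so that primality follows from
    the polynomial ring being a domain. *)
Definition var_ideal F : prime_idealr {mpoly K[n]} :=
  comap_ideal (kill_vars F) (@zero_ideal {mpoly K[n]}).

Lemma mem_var_ideal F f : (f \in var_ideal F) = (kill_vars F f == 0).
Proof. by []. Qed.

Lemma kill_varsX F m :
  kill_vars F 'X_[m]
  = if [exists i in F, (0 < m i)%N] then 0 else 'X_[m].
Proof.
rewrite /= mmapX /mmap1; case: ifP => [/existsP[i /andP[iF mi]]|/negbT].
  by rewrite (bigD1 i) //= iF expr0n eqn0Ngt mi mul0r.
rewrite negb_exists => /forallP mF; rewrite mpolyXE_id.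
apply: eq_bigr => i _; have := mF i; case: ifP => //= _.
by rewrite -eqn0Ngt => /eqP ->; rewrite !expr0.
Qed.

Lemma mem_var_idealX F m :
  ('X_[m] \in var_ideal F) = [exists i in F, (0 < m i)%N].
Proof.
rewrite mem_var_ideal kill_varsX; case: ifP => _; first exact: eqxx.
by apply/negP => /eqP/(congr1 (mcoeff m))/eqP; rewrite mcoeffX eqxx mcoeff0 oner_eq0.
Qed.

Lemma mem_var_idealXU F i : ('X_i \in var_ideal F) = (i \in F).
Proof.
rewrite mem_var_idealX; apply/existsP/idP => [[j]|iF]; last first.
  by exists i; rewrite iF mnm1E eqxx.
by rewrite mnm1E; case: eqP => [->|]; rewrite ?andbT ?andbF.
Qed.

(** An element of the kernel equals its difference with its image, and for each monomial this
    difference is zero or a multiple of a variable in [F]. *)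
Lemma var_ideal_ind F (J : {mpoly K[n]} -> Prop) :
    J 0 -> (forall f g, J f -> J g -> J (f + g)) ->
    (forall a f, J f -> J (a * f)) -> (forall i, i \in F -> J 'X_i) ->
  forall f, f \in var_ideal F -> J f.
Proof.
move=> J0 JD JM JX f; rewrite mem_var_ideal => /eqP f0.
rewrite -[f]subr0 -f0 {f0}; elim/mpolyind: f => [|c m f _ _ IH].
  by rewrite rmorph0 subr0.
rewrite rmorphD opprD addrACA; apply: JD IH.
rewrite -mul_mpolyC rmorphM /= mmapC -mulrBr; apply: (JM).
have := kill_varsX F m; rewrite /= => ->; case: ifP => [|_]; last by rewrite subrr.
case/existsP=> i /andP[iF mi]; rewrite subr0.
have -> : m = (m - U_(i) + U_(i))%MM by rewrite submK // lep1mP -lt0n.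
by rewrite mpolyXD; apply: (JM); apply: (JX).
Qed.

Lemma sub_var_ideal F q :
  (forall i, i \in F -> 'X_i \in q) -> {subset var_ideal F <= q}.
Proof.
move=> Fq; apply: (@var_ideal_ind _ (fun f => f \in q)) => //; first exact: rpred0.
  by move=> g h; apply: rpredD.
by move=> a g; apply: idealMr.
Qed.

Lemma mem_var_ideal1 i f :
  f \in var_ideal [set i] -> exists g, f = 'X_i * g.
Proof.
move: f; apply: var_ideal_ind => [|f g [f' ->] [g' ->]|a f [f' ->]|j /set1P ->].
- by exists 0; rewrite mulr0.
- by exists (f' + g'); rewrite mulrDr.
- by exists (a * f'); rewrite mulrCA.
- by exists 1; rewrite mulr1.
Qed.

Lemma mem_prime_monomial q (m : 'X_{1..n}) :
  reflect (exists2 i, (0 < m i)%N & 'X_i \in q) ('X_[m] \in q).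
Proof.
apply: (iffP idP) => [|[i mi iq]]; last first.
  have -> : m = (m - U_(i) + U_(i))%MM by rewrite submK // lep1mP -lt0n.
  by rewrite mpolyXD idealMr.
rewrite mpolyXE_id; elim/big_rec: _ => [|i x _ IH]; first by rewrite idealr1.
rewrite prime_idealrM => /orP[|/IH //]; case Ek: (m i) => [|k].
  by rewrite expr0 idealr1.
move=> iq; exists i; first by rewrite Ek.
move: iq; elim: k.+1 => [|j IHj]; first by rewrite expr0 idealr1.
by rewrite exprS prime_idealrM => /orP[|/IHj].
Qed.

End VariableIdeals.

(* Failed conversions would otherwise unfold these down to [mmap]. *)
Opaque kill_vars var_ideal.

(** * Chains of primes and dimension of quotient rings *)

Section ChainsInQuotients.
Variable R : comNzRingType.
Implicit Types p q : prime_idealr R.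

Definition quot_proj p : {rmorphism R -> {ideal_quot p}} :=
  \pi_{ideal_quot p}.

Lemma prime_chain_comap p e (c : nat -> prime_idealr {ideal_quot p}) :
  prime_chain e c ->
  prime_chain e (fun k => comap_ideal (quot_proj p) (c k)).
Proof.
move=> cc i ie; have [c1 c2] := cc i ie; split=> [x|c3].
  exact: c1.
by apply: c2 => z zc; have := c3 (repr z); rewrite !comap_idealE /= reprK; apply.
Qed.

Lemma sub_comap_pi p (q : prime_idealr {ideal_quot p}) :
  {subset p <= comap_ideal (quot_proj p) q}.
Proof.
move=> x xp; rewrite comap_idealE /= (_ : \pi x = 0) ?rpred0 //.
by rewrite -(rmorph0 (\pi_{ideal_quot p})); apply/eqP; rewrite -Quotient.idealrBE subr0.
Qed.

Lemma prime_chain_cons p e (c : nat -> prime_idealr R) :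
    {subset p <= c 0} -> ~ {subset c 0 <= p} -> prime_chain e c ->
  prime_chain e.+1 (fun k => if k is k'.+1 then c k' else p).
Proof. by move=> pc cp cc [|i] ie; last exact: cc. Qed.

Lemma prime_chain_quot p e (c : nat -> prime_idealr R) :
    (forall k, {subset p <= c k}) -> prime_chain e c ->
  exists c' : nat -> prime_idealr {ideal_quot p}, prime_chain e c'.
Proof.
move=> pc cc; exists (fun k => quot_ideal (pc k)) => i ie.
have [c1 c2] := cc i ie; split=> [z|c3].
  by rewrite -[z]reprK !quot_ideal_pi; apply: c1.
by apply: c2 => x xc; have := c3 (\pi x); rewrite !quot_ideal_pi; apply.
Qed.

End ChainsInQuotients.

Section DimensionOfQuotients.
Variables (K : fieldType) (n : nat).
Implicit Types p q : prime_idealr {mpoly K[n]}.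

Lemma zero_ideal_var i :
  {subset @zero_ideal {mpoly K[n]} <= var_ideal K [set i]} /\
  ~ {subset var_ideal K [set i] <= @zero_ideal {mpoly K[n]}}.
Proof.
split=> [f /eqP ->|/(_ 'X_i)]; first exact: rpred0.
rewrite mem_var_idealXU set11 => /(_ isT).
by apply/negP; apply: mpolyXU_neq0.
Qed.

(** The chain pulled back to the polynomial ring starts above [p], so the zero ideal can be
    prepended. *)
Lemma height1_quotient p i e (c : nat -> prime_idealr {ideal_quot p}) :
  'X_i \in p -> prime_chain e c -> (e < n)%N.
Proof.
move=> ip /prime_chain_comap cc.
have [_ iz] := zero_ideal_var i.
apply: prime_chain_mpoly; apply: prime_chain_cons (@zero_ideal {mpoly K[n]}) _ _ _ _ cc.
  by move=> f /eqP ->; apply: rpred0.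
move=> H; apply: iz => f fi; apply: H; apply: sub_comap_pi.
by apply: sub_var_ideal fi => j /set1P ->.
Qed.

(** Here both the zero ideal and (x_i) fit below the pulled-back chain; x_j makes the second
    inclusion strict. *)
Lemma height2_quotient p i j e (c : nat -> prime_idealr {ideal_quot p}) :
  i != j -> 'X_i \in p -> 'X_j \in p -> prime_chain e c -> (e.+1 < n)%N.
Proof.
move=> ij ip jp /prime_chain_comap cc.
have [z1 z2] := zero_ideal_var i.
have ic : {subset var_ideal K [set i] <= comap_ideal (quot_proj p) (c 0)}.
  move=> f fi; apply: sub_comap_pi.
  by apply: sub_var_ideal fi => k /set1P ->.
apply: prime_chain_mpoly.
apply: (prime_chain_cons z1 z2); apply: prime_chain_cons ic _ cc.
move/(_ 'X_j (sub_comap_pi _ jp)).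
by rewrite mem_var_idealXU inE eq_sym (negPf ij).
Qed.

End DimensionOfQuotients.

Lemma prime_chain_vars (K : fieldType) n (p : prime_idealr {mpoly K[n.+1]}) i :
  {subset p <= var_ideal K [set i]} ->
  exists c : nat -> prime_idealr {ideal_quot p}, prime_chain n c.
Proof.
(* [unbump i] numbers the variables other than x_i from 0 on, so [F k] is x_i with the first [k] of
   them. *)
move=> pi; pose F k := [set j : 'I_n.+1 | (j == i) || (unbump i j < k)%N].
have FS k : {subset var_ideal K (F k) <= var_ideal K (F k.+1)}.
  apply: sub_var_ideal => j; rewrite mem_var_idealXU !inE.
  by case/orP => [->//|/ltnW]; rewrite ltnS => ->; rewrite orbT.
apply: (@prime_chain_quot _ _ _ (fun k => var_ideal K (F k))) => k.
  move=> f /pi; apply: sub_var_ideal => j /set1P ->.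
  by rewrite mem_var_idealXU inE eqxx.
move=> kn; split=> [|Fk]; first exact: FS.
have [j [jF jF']] : exists j, j \in F k.+1 /\ j \notin F k.
  exists (lift i (Ordinal kn)).
  by rewrite !inE eq_sym (negPf (neq_lift _ _)) /= bumpK ltnn ltnSn.
by case/negP: jF'; rewrite -(mem_var_idealXU K); apply: Fk; rewrite mem_var_idealXU.
Qed.

(** The two hypotheses say that [p] and (x_i) have the same elements. *)
Lemma has_krull_dim_quot (K : fieldType) n (p : prime_idealr {mpoly K[n]}) i :
    'X_i \in p -> {subset p <= var_ideal K [set i]} ->
  has_krull_dim {ideal_quot p} n.-1.
Proof.
case: n p i => [|n] p i; first by case: i.
move=> ip pi; split; first exact: prime_chain_vars pi.
by move=> e c cc; rewrite -ltnS; apply: height1_quotient ip cc.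
Qed.

(** * Strong exchange *)

Section SequenceExtrema.
Variables (T : eqType) (f : T -> nat) (s : seq T).

Lemma seq_argmin : s != [::] -> exists2 x, x \in s & forall y, y \in s -> (f x <= f y)%N.
Proof.
case: s => // x0 s' _.
have ex : exists k, has (fun x => f x == k) (x0 :: s').
  by exists (f x0); rewrite /= eqxx.
case: (ex_minnP ex) => k /hasP[x xs /eqP <-] kmin; exists x => // y ys.
by apply: kmin; apply/hasP; exists y.
Qed.

Lemma bigmax_attained : s != [::] -> exists2 x, x \in s & f x = (\max_(y <- s) f y)%N.
Proof.
case: s => // x0 s' _; elim: s' x0 => [|x1 s' IH] x0.
  by exists x0; rewrite ?mem_head // big_seq1.
have [x xs fx] := IH x1; rewrite big_cons -fx.
case: (leqP (f x) (f x0)) => [le|lt].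
  by exists x0; rewrite ?mem_head //; apply/esym/maxn_idPl.
by exists x; rewrite 1?in_cons ?xs ?orbT //; apply/esym/maxn_idPr/ltnW.
Qed.

End SequenceExtrema.

Section ExchangeSystems.
Variables (n d : nat) (B : seq 'X_{1..n}).
Hypothesis B_neq0 : B != [::].
Hypothesis mdegB : forall u, u \in B -> mdeg u = d.
Hypothesis exchB : forall u v, u \in B -> v \in B -> forall i j,
  (v i < u i)%N -> (u j < v j)%N -> (u - U_(i) + U_(j))%MM \in B.

Let a (i : 'I_n) := (\max_(u <- B) u i)%N.

Lemma leq_coord_max (u : 'X_{1..n}) i : u \in B -> (u i <= a i)%N.
Proof. by move=> uB; apply: (leq_bigmax_seq (F := fun v : 'X_{1..n} => v i)). Qed.

Lemma leq_coord_mdeg (u : 'X_{1..n}) i : (u i <= mdeg u)%N.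
Proof. by rewrite mdegE (bigD1 i) //= leq_addr. Qed.

Lemma mdeg_eq_ltn (u v : 'X_{1..n}) i :
  mdeg u = mdeg v -> (v i < u i)%N -> exists j, (u j < v j)%N.
Proof.
move=> uv vui; apply/existsP; apply: contraPT uv => /existsPn H.
apply/eqP; rewrite neq_ltn; apply/orP; right.
rewrite !mdegE (bigD1 i) //= [X in (_ < X)%N](bigD1 i) //= -addSn leq_add //.
by apply: leq_sum => j _; rewrite leqNgt.
Qed.

Hypothesis zeroB : forall i, exists2 u, u \in B & u i = 0%N.

(** Among members with maximal j-th coordinate take one with least i-th coordinate. Were that
    positive, an exchange against a member vanishing at i would lower it; the coordinate raised is
    not j, which is already maximal. *)
Lemma exchange_zero_max i j :
  i != j -> exists v, [/\ v \in B, v i = 0%N & v j = a j].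
Proof.
move=> ij; have [v0 v0B v0i] := zeroB i.
pose Bj := [seq v : 'X_{1..n} <- B | v j == a j].
have Bj0 : Bj != [::].
  have [v vB vj] := bigmax_attained (fun v : 'X_{1..n} => v j) B_neq0.
  by rewrite -size_eq0 size_filter -lt0n -has_count; apply/hasP; exists v; rewrite ?vj.
have [v] := seq_argmin (fun v : 'X_{1..n} => v i) Bj0.
rewrite mem_filter => /andP[/eqP vj vB] vmin; exists v; split=> //.
case: (posnP (v i)) => // vi; have v0v : (v0 i < v i)%N by rewrite v0i.
have [l vl] := mdeg_eq_ltn (etrans (mdegB vB) (esym (mdegB v0B))) v0v.
have jl : l != j by apply: contraTneq vl => ->; rewrite -leqNgt vj leq_coord_max.
have il : l != i by apply: contraTneq vl => ->; rewrite -leqNgt ltnW.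
have /vmin : (v - U_(i) + U_(l))%MM \in Bj.
  rewrite mem_filter (exchB vB v0B) // andbT mnmDE mnmBE !mnm1E.
  by rewrite (negPf ij) (negPf jl) subn0 addn0 vj.
rewrite mnmDE mnmBE !mnm1E eqxx (negPf il) addn0.
by rewrite leqNgt subn1 prednK ?leqnn.
Qed.

Lemma exchange_veronese (w : 'X_{1..n}) :
  mdeg w = d -> (forall i, w i <= a i)%N -> w \in B.
Proof.
(* Truncated subtraction counts only the excess of [u] over [w]; an exchange lowering i and raising
   some j with u_j < w_j strictly decreases it. *)
move=> wd wa; pose dist (u : 'X_{1..n}) := (\sum_i (u i - w i))%N.
have [u uB umin] := seq_argmin dist B_neq0.
suff uw : forall i, (u i <= w i)%N.
  have -> // : w = u.
  apply/mnmP => i; apply/eqP; rewrite eqn_leq uw andbT leqNgt; apply/negP => uwi.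
  have [j] := mdeg_eq_ltn (etrans wd (esym (mdegB uB))) uwi.
  by rewrite ltnNge uw.
move=> i; rewrite leqNgt; apply/negP => wui.
have [j ujw] := mdeg_eq_ltn (etrans (mdegB uB) (esym wd)) wui.
have ij : i != j by apply: contraTneq ujw => <-; rewrite -leqNgt ltnW.
have [v [vB vi vj]] := exchange_zero_max ij.
have u'B : (u - U_(i) + U_(j))%MM \in B.
  apply: (exchB uB vB); first by rewrite vi (leq_ltn_trans _ wui).
  by rewrite vj (leq_trans ujw).
have := umin _ u'B; rewrite leqNgt => /negP; apply.
rewrite /dist (bigD1 i) //= [X in (_ < X)%N](bigD1 i) //= -addSn leq_add //.
  rewrite mnmDE mnmBE !mnm1E eqxx eq_sym (negPf ij) addn0 subn1.
  by rewrite -subSn -ltnS prednK // (leq_ltn_trans _ wui).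
apply: leq_sum => k ki; rewrite mnmDE mnmBE !mnm1E eq_sym (negPf ki) subn0.
case: eqP => [<-|_]; last by rewrite addn0.
by rewrite addn1 (eqP (_ : (u j).+1 - w j == 0)%N) // subn_eq0.
Qed.

Lemma exchange_veronese_bounds :
  (forall i, a i <= d)%N /\ (d <= \sum_i a i)%N.
Proof.
split=> [i|].
  have [v vB vi] := bigmax_attained (fun v : 'X_{1..n} => v i) B_neq0.
  by rewrite /a -vi -(mdegB vB) leq_coord_mdeg.
have [u uB _] := seq_argmin (fun=> 0%N) B_neq0.
by rewrite -(mdegB uB) mdegE leq_sum // => i _; apply: leq_coord_max.
Qed.

End ExchangeSystems.

(** * Bases of a discrete polymatroid *)

Section Bases.
Variables (n : nat) (P : {fset 'X_{1..n}}).
Hypothesis polyP : discrete_polymatroid P.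

Lemma polymatroid_neq0 : (P : seq 'X_{1..n}) != [::].
Proof.
have [P0 _ _] := polyP; apply: contraNneq P0 => E; apply/eqP/fsetP => v.
by rewrite inE -[LHS]/(v \in (P : seq _)) E.
Qed.

Definition bases := [seq u <- P | mdeg u == (\max_(v <- P) mdeg v)%N].

(** A strictly larger vector has larger modulus, so maximal modulus implies maximality; conversely
    the augmentation axiom enlarges any element of smaller modulus. *)
Lemma basesP u : reflect (base P u) (u \in bases).
Proof.
have [_ _ exP] := polyP.
have leP v : v \in P -> (mdeg v <= \max_(w <- P) mdeg w)%N.
  by move=> vP; apply: (leq_bigmax_seq (F := @mdeg n)).
apply: (iffP idP) => [|[uP umax]]; rewrite mem_filter.
  case/andP=> /eqP ud uP; split=> // v vP /mnm_lepP uv.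
  apply/mnmP => i; apply/eqP; rewrite eqn_leq uv andbT leqNgt; apply/negP => uvi.
  have := leP _ vP; rewrite -ud leqNgt => /negP; apply.
  rewrite !mdegE (bigD1 i) //= [X in (_ < X)%N](bigD1 i) //= -addSn leq_add //.
  by apply: leq_sum.
have [v vP vd] := bigmax_attained (@mdeg n) polymatroid_neq0.
apply/andP; split=> //; rewrite eqn_leq leP //= -vd leqNgt; apply/negP => uv.
have [i _ uiP] := exP _ _ uP vP uv.
have /mnmP/(_ i) := umax _ uiP (lem_addr _ _).
by rewrite mnmDE mnm1E eqxx => /eqP; rewrite -[X in _ == X]addn0 eqn_add2l.
Qed.

Lemma bases_neq0 : bases != [::].
Proof.
have [v vP vd] := bigmax_attained (@mdeg n) polymatroid_neq0.
by rewrite -size_eq0 size_filter -lt0n -has_count; apply/hasP; exists v; rewrite ?vd.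
Qed.

Lemma strong_exchange_veronese : strong_exchange P ->
    (forall i, exists2 u : 'X_{1..n}, u \in bases & u i = 0%N) ->
  exists (d : nat) (a : 'I_n -> nat),
    [/\ forall i, (a i <= d)%N, (d <= \sum_(i < n) a i)%N
      & forall u : 'X_{1..n}, base P u <-> mdeg u = d /\ forall i, (u i <= a i)%N].
Proof.
move=> exP zP; pose d := (\max_(v <- P) mdeg v)%N.
have degB u : u \in bases -> mdeg u = d.
  by rewrite mem_filter => /andP[/eqP].
have exB (u v : 'X_{1..n}) : u \in bases -> v \in bases -> forall i j,
    (v i < u i)%N -> (u j < v j)%N -> (u - U_(i) + U_(j))%MM \in bases.
  by move=> /basesP ub /basesP vb i j vi uj; apply/basesP; apply: exP vi uj.
have [ad da] := exchange_veronese_bounds bases_neq0 degB.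
exists d, (fun i => \max_(u <- bases) (u : 'X_{1..n}) i)%N; split=> // u; split.
  by move=> /basesP ub; split=> [|i]; [apply: degB|apply: leq_coord_max].
case=> ud ua; apply/basesP; exact: (exchange_veronese bases_neq0 degB exB zP ud ua).
Qed.

End Bases.

(** * Minimal primes and the radical *)

Lemma prime_idealrX (R : comNzRingType) (p : prime_idealr R) x k :
  x ^+ k \in p -> x \in p.
Proof.
elim: k => [|k IH]; first by rewrite expr0 idealr1.
by rewrite exprS prime_idealrM => /orP[|/IH].
Qed.

Section IdealGenerators.
Variables (R : comNzRingType) (G : R -> Prop).

Lemma ideal_gen_incl f : G f -> ideal_gen G f.
Proof.
move=> Gf; exists [:: (1, f)]; last by rewrite big_seq1 mul1r.
by move=> ag; rewrite inE => /eqP ->.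
Qed.

Lemma ideal_gen_mull a f : ideal_gen G f -> ideal_gen G (a * f).
Proof.
case=> s sG ->; exists [seq (a * x.1, x.2) | x <- s].
  by move=> ag /mapP[x /sG Gx ->].
by rewrite big_map big_distrr /=; apply: eq_bigr => x _; rewrite mulrA.
Qed.

Lemma ideal_gen_sub (p : prime_idealr R) :
  (forall f, G f -> f \in p) -> forall f, ideal_gen G f -> f \in p.
Proof.
move=> Gp f [s sG ->]; rewrite big_seq; apply: rpred_sum => ag /sG /Gp.
exact: idealMr.
Qed.

Lemma eq_ideal_gen (G' : R -> Prop) :
  (forall f, G f <-> G' f) -> eq_ideal (ideal_gen G) (ideal_gen G').
Proof. by move=> GG' f; split=> -[s sG ->]; exists s => // ag /sG /GG'. Qed.

End IdealGenerators.

Section Divisibility.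
Variables (K : fieldType) (n : nat).
Implicit Types f g : {mpoly K[n]}.

Lemma prod_vars_dvd f (s : seq 'I_n) : uniq s ->
    (forall i, i \in s -> f \in var_ideal K [set i]) ->
  exists a, f = a * \prod_(i <- s) 'X_i.
Proof.
elim: s f => [|i s IH] f /=; first by exists f; rewrite big_nil mulr1.
case/andP=> is_ us fs; have [g Ef] := mem_var_ideal1 (fs i (mem_head i s)).
have [|a Ea] := IH g us; last first.
  by exists a; rewrite big_cons Ef Ea mulrCA.
move=> j js; have := fs j; rewrite inE js orbT => /(_ isT).
rewrite Ef prime_idealrM mem_var_idealXU inE => /orP[/eqP ij|//].
by rewrite ij js in is_.
Qed.

(** Induction on the degree: a variable x_i of the monomial divides [a] or [g]. It can be cancelled,
    with the quotient of [g] still in [p], unless it divides [g] and lies in [p]; then it is the one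
    sought. *)
Lemma prime_var_of_dvd_monomial (p : prime_idealr {mpoly K[n]}) m a g :
    a * g = 'X_[m] -> g \in p ->
  exists2 j, 'X_j \in p & g \in var_ideal K [set j].
Proof.
elim: {m}(mdeg m) {-2}m (erefl (mdeg m)) a g => [|k IH] m mk a g ag gp.
  move/eqP: mk; rewrite mdeg_eq0 => /eqP m0.
  by have := idealMr a gp; rewrite ag m0 mpolyX0 idealr1.
have [i mi] : exists i, (0 < m i)%N.
  apply/existsP; apply: contra_eqT mk => /existsPn m0.
  by rewrite mdegE big1 // => i _; apply/eqP; rewrite eqn0Ngt m0.
have Em : m = (m - U_(i) + U_(i))%MM by rewrite submK // lep1mP -lt0n.
have mk' : mdeg (m - U_(i)) = k.
  by apply/eqP; rewrite -eqSS -mk [in X in _ == X]Em mdegD mdeg1 addn1.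
have : a * g \in var_ideal K [set i].
  by rewrite ag Em mpolyXD idealMr // mem_var_idealXU set11.
rewrite Em mpolyXD in ag; rewrite prime_idealrM => /orP[|gi].
  case/mem_var_ideal1 => a' Ea; apply: (IH _ mk' a' g) => //.
  by apply: (mulfI (mpolyXU_neq0 _ i)); rewrite mulrA -Ea ag mulrC.
case: (boolP ('X_i \in p)) => ip; first by exists i.
have [g' Eg] := mem_var_ideal1 gi.
have g'p : g' \in p by move: gp; rewrite Eg prime_idealrM (negPf ip).
have [|j jp g'j] := IH _ mk' a g' _ g'p; last first.
  by exists j; [exact: jp | rewrite Eg idealMr].
by apply: (mulfI (mpolyXU_neq0 _ i)); rewrite mulrCA -Eg ag mulrC.
Qed.

End Divisibility.

Section MonomialIdealPrimes.
Variables (K : fieldType) (n : nat) (P : {fset 'X_{1..n}}).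
Hypothesis polyP : discrete_polymatroid P.
Local Notation I := (polymatroidal_ideal (K := K) P).
Implicit Types (F : {set 'I_n}) (p : prime_idealr {mpoly K[n]}).

Lemma polymatroidal_idealX u : base P u -> I 'X_[u].
Proof. by move=> ub; apply: ideal_gen_incl; exists u. Qed.

Lemma polymatroidal_ideal_sub p :
  (forall u, base P u -> 'X_[u] \in p) -> forall f, I f -> f \in p.
Proof. by move=> pb; apply: ideal_gen_sub => _ [u ub ->]; apply: pb. Qed.

Definition base_cover F :=
  all (fun u : 'X_{1..n} => [exists i in F, (0 < u i)%N]) (bases P).

(** A prime containing I contains a variable of every generator, so its variables form a cover;
    inside [F], minimality makes this cover all of [F]. *)
Lemma minimal_prime_var_ideal F :
  minset base_cover F -> minimal_prime I (var_ideal K F).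
Proof.
case/minsetP=> /allP cF minF; split=> [|q Iq qF].
  by apply: polymatroidal_ideal_sub => u /(basesP polyP)/cF; rewrite mem_var_idealX.
apply: sub_var_ideal => i iF; pose F' := [set i | 'X_i \in q].
have F'F : F' \subset F.
  by apply/subsetP => j; rewrite inE => /qF; rewrite mem_var_idealXU.
suff cF' : base_cover F' by move: iF; rewrite -(minF F' cF' F'F) inE.
apply/allP => u /(basesP polyP) /polymatroidal_idealX /Iq /mem_prime_monomial[j uj jq].
by apply/existsP; exists j; rewrite inE jq.
Qed.

Lemma base_cover_neq0 F : base_cover F -> exists i, i \in F.
Proof.
have := bases_neq0 polyP; rewrite /base_cover; case: (bases P) => //= u s _.
by case/andP => /existsP[i /andP[iF _]] _; exists i.
Qed.

Lemma minset_base_cover1 i : base_cover [set i] -> minset base_cover [set i].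
Proof.
move=> ci; apply/minsetP; split=> // F cF; rewrite subset1 => /orP[/eqP //|/eqP F0].
by have [j] := base_cover_neq0 cF; rewrite F0 inE.
Qed.

Definition common_vars :=
  [set i | all (fun u : 'X_{1..n} => (0 < u i)%N) (bases P)].

Lemma base_cover1 i : base_cover [set i] = (i \in common_vars).
Proof.
rewrite inE; apply: eq_all => u; apply/existsP/idP => [[j]|ui].
  by rewrite inE => /andP[/eqP ->].
by exists i; rewrite set11.
Qed.

End MonomialIdealPrimes.

(** * Equidimensionality and principal radical *)

Section Equidimensional.
Variables (K : fieldType) (n : nat) (P : {fset 'X_{1..n}}).
Hypothesis polyP : discrete_polymatroid P.
Local Notation I := (polymatroidal_ideal (K := K) P).

Lemma common_vars_neq0 :
  strong_exchange P -> ~ veronese_type I -> exists i, i \in common_vars P.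
Proof.
move=> exP nV; apply/existsP; apply: contra_notT nV => /existsPn nD.
have [|d [a [ad da baseE]]] := strong_exchange_veronese polyP exP.
  move=> i; have := nD i; rewrite inE -has_predC => /hasP[u ub ui].
  by exists u => //; apply/eqP; rewrite eqn0Ngt.
exists d, a; split=> //; apply: eq_ideal_gen => f.
by split=> -[u /baseE ub ->]; exists u.
Qed.

Lemma equidimensional_base :
    (exists i, i \in common_vars P) -> equidimensional I ->
  exists2 u, base P u & forall i, (0 < u i)%N -> i \in common_vars P.
Proof.
case=> i0 i0D [d eqI].
have [_ dmax] := eqI _ (minimal_prime_var_ideal K polyP
  (minset_base_cover1 polyP (etrans (base_cover1 P i0) i0D))).
have i0V : 'X_i0 \in var_ideal K [set i0] by rewrite mem_var_idealXU set11.
(* The minimal prime (x_i0) already has a quotient of dimension n - 1. *)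
have nd : (n <= d.+1)%N.
  have [[c cc] _] := has_krull_dim_quot i0V (fun _ => id).
  by rewrite -add1n -leq_subLR subn1; apply: dmax cc.
have [/hasP[u ub]|/hasPn noB] := boolP (has (fun u : 'X_{1..n} =>
    [forall i, (0 < u i)%N ==> (i \in common_vars P)]) (bases P)).
  move/forallP=> uD; exists u; first exact/(basesP polyP).
  by move=> i; apply/implyP.
(* If every base meets the complement of the common variables, a minimal cover lies there. Two
   elements in it would force dimension at most n - 2; a single one would be a common variable. *)
have /minset_exists[F minF FD] : base_cover P (~: common_vars P).
  apply/allP => u /noB; rewrite negb_forall => /existsP[i].
  by rewrite negb_imply => /andP[ui iD]; apply/existsP; exists i; rewrite inE iD.
have [cF _] := minsetP minF; have [i iF] := base_cover_neq0 polyP cF.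
have [/set0Pn[j]|] := boolP (F :\ i != set0).
  rewrite !inE => /andP[ji jF].
  have [[c cc] _] := eqI _ (minimal_prime_var_ideal K polyP minF).
  have := height2_quotient ji _ _ cc; rewrite !mem_var_idealXU => /(_ jF iF).
  by rewrite ltnNge nd.
rewrite negbK setD_eq0 subset1 => /orP[/eqP Fi|/eqP F0]; last by rewrite F0 inE in iF.
have := subsetP FD i iF; rewrite inE -base_cover1.
by rewrite -Fi cF.
Qed.

Lemma principal_radical :
    (exists2 u, base P u & forall i, (0 < u i)%N -> i \in common_vars P) ->
  principal_ideal (radical I).
Proof.
case=> u ub uD; exists (\prod_(i <- enum (common_vars P)) 'X_i) => f; split.
  case=> k fk; apply: prod_vars_dvd => [|i]; first exact: enum_uniq.
  rewrite mem_enum -base_cover1 => /allP ci; apply: (@prime_idealrX _ _ _ k).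
  apply: polymatroidal_ideal_sub fk => v /(basesP polyP)/ci.
  by rewrite mem_var_idealX.
(* The modulus of [u] bounds each of its exponents, so this power of the product is divisible by
   x^u. *)
case=> a ->; exists (mdeg u); rewrite exprMn; apply: ideal_gen_mull.
rewrite mprodXE mpolyXn; set m := (_ *+ _)%MM.
have um : (u <= m)%MM.
  apply/mnm_lepP => i; rewrite mulmnE; case: (posnP (u i)) => [-> //|/uD iD].
  apply: leq_trans (leq_coord_mdeg u i) _; rewrite leq_pmull // mnm_sumE.
  by rewrite (big_rem i) ?mem_enum //= mnm1E eqxx.
rewrite -(submK um) mpolyXD; apply: ideal_gen_mull.
exact: polymatroidal_idealX.
Qed.

Lemma principal_radical_equidimensional :
  principal_ideal (radical I) -> equidimensional I.
Proof.
case=> g gP; exists n.-1 => p [Ip pmin].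
have [k gk] : radical I g by apply/gP; exists 1; rewrite mul1r.
have gp : g \in p by apply: prime_idealrX (Ip _ gk).
have := bases_neq0 polyP; case E: (bases P) => [//|u s] _.
have ub : base P u by apply/(basesP polyP); rewrite E mem_head.
have /gP[a ag] : radical I 'X_[u].
  by exists 1%N; rewrite expr1; apply: polymatroidal_idealX.
have [j jp gj] := prime_var_of_dvd_monomial (esym ag) gp.
have pj : {subset p <= var_ideal K [set j]}.
  (* I lies in (g), which lies in (x_j), and (x_j) lies in [p]; minimality forces equality. *)
  apply: pmin => [f If|]; last by apply: sub_var_ideal => i /set1P ->.
  have /gP[b ->] : radical I f by exists 1%N; rewrite expr1.
  exact: idealMr.
exact: has_krull_dim_quot jp pj.
Qed.

End Equidimensional.

Lemma eq_ideal_equidimensional (R : comNzRingType) (J J' : R -> Prop) :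
  eq_ideal J J' -> equidimensional J -> equidimensional J'.
Proof.
move=> JJ' [d dJ]; exists d => p [pJ pmin]; apply: dJ; split=> [f /JJ'|q qJ].
  exact: pJ.
by apply: pmin => f /JJ'; apply: qJ.
Qed.

Lemma eq_ideal_principal_radical (R : comNzRingType) (J J' : R -> Prop) :
  eq_ideal J J' -> principal_ideal (radical J) -> principal_ideal (radical J').
Proof.
move=> JJ' [g gP]; exists g => f; rewrite -gP.
by split=> -[k /JJ' fk]; exists k.
Qed.

Theorem corollary2p10 (K : fieldType) (n : nat) (I : {mpoly K[n]} -> Prop)
    (hI : strong_polymatroidal I) (hV : ~ veronese_type I) :
  equidimensional I <-> principal_ideal (radical I).
Proof.
have [P [polyP exP EI]] := hI.
have EI' : eq_ideal (polymatroidal_ideal P) I by move=> f; rewrite (EI f).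
have nV : ~ veronese_type (polymatroidal_ideal (K := K) P).
  case=> d [a [ad da EV]]; apply: hV; exists d, a; split=> // f.
  by rewrite (EI f).
split.
  move/(eq_ideal_equidimensional EI) => dimI.
  apply: (eq_ideal_principal_radical EI'); apply: principal_radical => //.
  by apply: equidimensional_base dimI => //; apply: common_vars_neq0 nV.
move/(eq_ideal_principal_radical EI) => /(principal_radical_equidimensional polyP).
exact: eq_ideal_equidimensional.
Qed.
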